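(* Let $H$ be a Hadamard matrix of order $n$ with rows $r_1,\dots,r_n$, let $C_i=r_i^\top r_i$ ($1\le i\le n$) and $C_0=O_n$. Let $\ell$ be an odd integer with $1<\ell<n-1$, and suppose that $\sum_{i=1}^\ell C_i=\ell I_n+aA+b(J_n-A-I_n)$ for integers $a\neq b$ and a symmetric $(0,1)$-matrix $A$ with zero diagonal, and that $C_iJ_n=O_n$ for $i=1,\dots,\ell$. Let $L=(L_{i,j})$ be a symmetric Latin square of order $\ell+1$ on the symbol set $\{0,1,\dots,\ell\}$ with all diagonal entries equal to $0$, and let $\tilde L=(C_{L_{i,j}})_{i,j}$ be the $(\ell+1)n\times(\ell+1)n$ block matrix. Define $A_0=I_{(\ell+1)n}$, $A_1=I_{\ell+1}\otimes A$, $A_2=I_{\ell+1}\otimes(J_n-A-I_n)$, and let $A_3,A_4$ be the $(0,1)$-matrices with disjoint supports such that $\tilde L=A_3-A_4$. Then $\{A_0,A_1,A_2,A_3,A_4\}$ is a symmetric association scheme with $4$ classes.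
   Context: A Hadamard matrix of order $n$ is an $n\times n$ $\{1,-1\}$-matrix $H$ with $HH^\top=nI_n$; $J_n$ is the all-ones and $O_n$ the zero matrix. A $d$-class commutative association scheme on a finite set $X$ is a set of nonzero $(0,1)$-matrices $A_0,\dots,A_d$ indexed by $X$ with $A_0=I$, $\sum_i A_i=J$, each $A_i^\top\in\{A_0,\dots,A_d\}$ (with $A_i^\top\ne A_0$ for $i\ge1$), $A_iA_j=\sum_k p_{i,j}^kA_k$ for nonnegative integers $p_{i,j}^k$, and $A_iA_j=A_jA_i$; it is symmetric if all $A_i$ are symmetric, non-symmetric otherwise. *)

(* Defs.v *)
From mathcomp Require Export all_boot all_order all_algebra.
From mathcomp Require Export mxtens.

Set Implicit Arguments.
Unset Strict Implicit.
Unset Printing Implicit Defensive.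

Import GRing.Theory.
Local Open Scope ring_scope.

Definition zero_one_mx n (M : 'M[int]_n) : Prop :=
  forall i j, M i j = 0 \/ M i j = 1.

Definition disjoint_supports n (M N : 'M[int]_n) : Prop :=
  forall i j, M i j = 0 \/ N i j = 0.

Definition Jmx n : 'M[int]_n := const_mx 1.

Definition hadamard n (H : 'M[int]_n) : Prop :=
  (forall i j, H i j = 1 \/ H i j = -1) /\ H *m H^T = n%:R%:M.

(* [hadamard_aux H k] is C_k: the rows r_1, ..., r_n of H are rows 0, ..., n-1
   of the matrix, so C_(i+1) is built from [row i H]; C_0 = 0. The value 0 for
   k > n is a junk value. *)
Definition hadamard_aux n (H : 'M[int]_n) (k : nat) : 'M[int]_n :=
  if k is j.+1 then
    if insub j is Some i then (row i H)^T *m row i H else 0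
  else 0.

Lemma hadamard_aux0 n (H : 'M[int]_n) : hadamard_aux H 0 = 0.
Proof. by []. Qed.

Lemma hadamard_auxS n (H : 'M[int]_n) (i : 'I_n) :
  hadamard_aux H i.+1 = (row i H)^T *m row i H.
Proof. by rewrite /hadamard_aux valK. Qed.

Definition latin_square m (L : 'M['I_m]_m) : Prop :=
  (forall i s, exists! j, L i j = s) /\ (forall j s, exists! i, L i j = s).

(* The m x m block matrix with n x n blocks [B i j], using the same indexing of
   rows and columns as the Kronecker product [*t]. *)
Definition sqblock_mx m n (B : 'I_m -> 'I_m -> 'M[int]_n) : 'M[int]_(m * n) :=
  \matrix_(x, y) B (mxtens_unindex x).1 (mxtens_unindex y).1
                   (mxtens_unindex x).2 (mxtens_unindex y).2.

Lemma sqblock_mxE m n (B : 'I_m -> 'I_m -> 'M[int]_n) i j k l :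
  sqblock_mx B (mxtens_index (i, k)) (mxtens_index (j, l)) = B i j k l.
Proof. by rewrite mxE !mxtens_indexK. Qed.

Lemma sqblock_mx_tens m n (P : 'M[int]_m) (Q : 'M[int]_n) :
  sqblock_mx (fun i j => P i j *: Q) = P *t Q.
Proof. by apply/matrixP=> x y; rewrite !mxE. Qed.

Record comm_assoc_scheme d N (A : d.+1.-tuple 'M[int]_N) : Prop := {
  scheme_neq0 : forall i, tnth A i != 0;
  scheme_01 : forall i, zero_one_mx (tnth A i);
  scheme_id : tnth A ord0 = 1%:M;
  scheme_sum : \sum_(i < d.+1) tnth A i = Jmx N;
  scheme_tr : forall i, exists j, (tnth A i)^T = tnth A j;
  scheme_tr0 : forall i, i != ord0 -> (tnth A i)^T != tnth A ord0;
  scheme_mul : exists p : 'I_d.+1 -> 'I_d.+1 -> 'I_d.+1 -> nat,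
    forall i j,
      tnth A i *m tnth A j = \sum_(k < d.+1) (p i j k)%:R *: tnth A k;
  scheme_comm : forall i j, tnth A i *m tnth A j = tnth A j *m tnth A i
}.

Definition symmetric_assoc_scheme d N (A : d.+1.-tuple 'M[int]_N) : Prop :=
  comm_assoc_scheme A /\ forall i, (tnth A i)^T = tnth A i.

(* Main.v *)
(** Write [S] for the sum of [C_1, ..., C_l] and [W] for the block matrix
    [A3 - A4].  Up to denominators dividing [2 * (a - b)], the matrices
    [A_0, ..., A_4] have the same linear span as [I], [I (x) J], [I (x) S],
    [J (x) J] and [W].  Orthogonality of the rows of [H] gives
    [C_i C_j = delta_ij n C_i], so [S C_i = n C_i], and the Latin square property
    then gives [W^2 = n (I (x) S)]; with [C_i J = 0] these five matrices are
    symmetric and closed under multiplication up to scalars.  Hence every product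
    [A_i A_j] is constant on the support of each [A_k], and this constant is the
    (automatically nonnegative integral) intersection number. *)

Require Import Defs.
From mathcomp Require Import ring zify.

Set Implicit Arguments.
Unset Strict Implicit.
Unset Printing Implicit Defensive.

Import Order.TTheory GRing.Theory Num.Theory.
Local Open Scope ring_scope.

(** * Schemes from matrices constant on classes *)

(** A pure sublattice of the integer matrices. The last closure property replaces division by [2] or
    [a - b], so a property can pass from a rational spanning set to the [A_i] without leaving
    [int]. *)
Record saturated N (P : 'M[int]_N -> Prop) : Prop := {
  saturated0 : P 0;
  saturatedP : forall c M M', P M -> P M' -> P (c *: M + M');
  saturatedZ : forall c M, c <> 0 -> P (c *: M) -> P M
}.

Lemma saturated_scale N (P : 'M[int]_N -> Prop) (satP : saturated P) c M :
  P M -> P (c *: M).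
Proof.
by move=> PM; rewrite -[_ *: _]addr0; apply: saturatedP => //; apply: saturated0.
Qed.

Lemma saturated_mull N (P : 'M[int]_N -> Prop) (satP : saturated P) X :
  saturated (fun M => P (X *m M)).
Proof.
split=> [|c M M' PM PM'|c M c0].
- by rewrite mulmx0; apply: saturated0.
- by rewrite mulmxDr -scalemxAr; apply: saturatedP.
- by rewrite -scalemxAr; apply: saturatedZ.
Qed.

Lemma saturated_mulr N (P : 'M[int]_N -> Prop) (satP : saturated P) X :
  saturated (fun M => P (M *m X)).
Proof.
split=> [|c M M' PM PM'|c M c0].
- by rewrite mul0mx; apply: saturated0.
- by rewrite mulmxDl -scalemxAl; apply: saturatedP.
- by rewrite -scalemxAl; apply: saturatedZ.
Qed.

Lemma scalemx_int_inj N (c : int) (M M' : 'M[int]_N) :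
  c <> 0 -> c *: M = c *: M' -> M = M'.
Proof.
move=> /eqP c0 /matrixP e; apply/matrixP=> x y.
by move: (e x y); rewrite !mxE; apply: mulfI.
Qed.

Lemma saturated_sym N : saturated (fun M : 'M[int]_N => M^T = M).
Proof.
split=> [|c M M' sM sM'|c M c0]; first exact: trmx0.
  by rewrite linearD linearZ /= sM sM'.
by rewrite linearZ /=; apply: scalemx_int_inj.
Qed.

(** When the matrices of [A] are a 0/1 partition of [J], this is membership in their span, phrased
    so that no coefficients are needed. *)
Definition class_constant d N (A : d.-tuple 'M[int]_N) (M : 'M[int]_N) : Prop :=
  forall x y x' y',
    (forall k, tnth A k x y = tnth A k x' y') -> M x y = M x' y'.

Lemma saturated_class_constant d N (A : d.-tuple 'M[int]_N) :
  saturated (class_constant A).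
Proof.
split=> [x y x' y' _|c M M' cM cM' x y x' y' e|c M /eqP c0 cM x y x' y' e].
- by rewrite !mxE.
- by rewrite !mxE (cM _ _ _ _ e) (cM' _ _ _ _ e).
- by move: (cM _ _ _ _ e); rewrite !mxE; apply: mulfI.
Qed.

Section ZeroOnePartition.

Variables (d N : nat) (A : d.-tuple 'M[int]_N).
Hypothesis A01 : forall i, zero_one_mx (tnth A i).
Hypothesis sumA : \sum_(i < d) tnth A i = Jmx N.

Lemma partition_sum x y : \sum_(i < d) tnth A i x y = 1.
Proof. by rewrite -summxE sumA mxE. Qed.

Lemma partition_ge0 i x y : 0 <= tnth A i x y.
Proof. by case: (A01 i x y) => ->. Qed.

(** Nonnegative entries sum to 1 at each position, so one entry equal to 1 leaves 0 for all the
    others. *)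
Lemma partition_entry k x y :
  tnth A k x y = 1 -> forall j, tnth A j x y = (j == k)%:R.
Proof.
move=> Ak j; have [->|jk] := eqVneq j k; first by rewrite Ak.
have := partition_sum x y; rewrite (bigD1 k) //= Ak => /eqP.
rewrite -subr_eq0 addrAC subrr add0r => /eqP s0.
by apply: (psumr_eq0P _ s0) => // i _; apply: partition_ge0.
Qed.

Lemma partition_class x y : exists k, tnth A k x y = 1.
Proof.
case: (pickP (fun k => tnth A k x y == 1)) => [k /eqP|none]; first by exists k.
have := partition_sum x y; rewrite big1 // => i _.
by case: (A01 i x y) => // /eqP; rewrite none.
Qed.

(** The coefficient of [A_k] is the value of [M] at a chosen position [r k] in the support of [A_k];
    nonnegativity makes it a natural number. *)
Lemma class_constant_comb (M : 'M[int]_N) :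
  (forall i, tnth A i != 0) -> (forall x y, 0 <= M x y) -> class_constant A M ->
  exists p : 'I_d -> nat, M = \sum_(k < d) (p k)%:R *: tnth A k.
Proof.
move=> A0 M0 cM.
have rep k : exists xy, tnth A k xy.1 xy.2 == 1.
  have [xy /negP nz|none] := pickP (fun xy => tnth A k xy.1 xy.2 != 0).
    by exists xy; case: (A01 k xy.1 xy.2) => e; [case: nz; apply/eqP|apply/eqP].
  case/eqP: (A0 k); apply/matrixP=> x y; rewrite !mxE.
  by have /negbFE/eqP := none (x, y).
pose r k := xchoose (rep k).
exists (fun k => `|M (r k).1 (r k).2|%N); apply/matrixP=> x y.
have [k Ak] := partition_class x y; have Aj := partition_entry Ak.
rewrite summxE (bigD1 k) //= big1 => [|j jk]; last first.
  by rewrite !mxE Aj (negbTE jk) mulr0.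
have /eqP Ark := xchooseP (rep k); rewrite -/(r k) in Ark.
rewrite addr0 !mxE Ak mulr1 natz gez0_abs //; apply: cM => j.
by rewrite Aj (partition_entry Ark).
Qed.

End ZeroOnePartition.

(** Products of 0/1 matrices are nonnegative, so class constancy yields the intersection numbers.
    Commutativity is free: [A_i A_j] is a combination of symmetric matrices, hence equals its
    transpose [A_j A_i]. *)
Lemma symmetric_assoc_scheme_class_constant d N (A : d.+1.-tuple 'M[int]_N) :
  (forall i, tnth A i != 0) -> (forall i, zero_one_mx (tnth A i)) ->
  tnth A ord0 = 1%:M -> \sum_(i < d.+1) tnth A i = Jmx N ->
  (forall i, (tnth A i)^T = tnth A i) ->
  (forall i j, class_constant A (tnth A i *m tnth A j)) ->
  symmetric_assoc_scheme A.
Proof.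
move=> A0 A01 Aid sumA symA cA.
have prod i j : exists p : 'I_d.+1 -> nat,
    tnth A i *m tnth A j = \sum_(k < d.+1) (p k)%:R *: tnth A k.
  apply: class_constant_comb => // x y; rewrite mxE sumr_ge0 // => z _.
  by rewrite mulr_ge0 ?partition_ge0.
split=> //; split=> // [i|i i0||i j].
- by exists i.
(* If [A_i] were the identity class, any entry 1 of it would also be an entry 1 of [A_0], against
   disjointness; so [A_i] would vanish. *)
- apply: contraNneq (A0 i); rewrite symA => Ai; apply/eqP/matrixP=> x y.
  rewrite mxE; case: (A01 i x y) => // Aixy.
  by have := partition_entry A01 sumA Aixy ord0; rewrite -Ai Aixy eq_sym (negbTE i0).
- exact: (fin_all_exists (fun i => fin_all_exists (prod i))).
- have [p pE] := prod i j; rewrite -[RHS]trmxK trmx_mul !symA pE linear_sum /=.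
  by apply: eq_bigr => k _; rewrite linearZ /= symA.
Qed.

(** * Block matrices *)

Lemma mulmx_sqblock m n (B C : 'I_m -> 'I_m -> 'M[int]_n) :
  sqblock_mx B *m sqblock_mx C = sqblock_mx (fun i j => \sum_k B i k *m C k j).
Proof.
apply/matrixP=> x y; case: (mxtens_indexP x) => i p.
case: (mxtens_indexP y) => j q; rewrite sqblock_mxE summxE mxE.
under [RHS]eq_bigr do rewrite mxE.
rewrite pair_big /= (reindex (@mxtens_index m n)) /=.
  by apply: eq_bigr => -[k r] _; rewrite !sqblock_mxE.
by exists (@mxtens_unindex m n) => z _; [apply: mxtens_indexK|apply: mxtens_unindexK].
Qed.

Lemma eq_sqblock m n (B C : 'I_m -> 'I_m -> 'M[int]_n) :
  (forall i j, B i j = C i j) -> sqblock_mx B = sqblock_mx C.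
Proof. by move=> e; apply/matrixP=> x y; rewrite !mxE e. Qed.

Lemma tr_sqblock m n (B : 'I_m -> 'I_m -> 'M[int]_n) :
  (sqblock_mx B)^T = sqblock_mx (fun i j => (B j i)^T).
Proof. by apply/matrixP=> x y; rewrite !mxE. Qed.

Lemma scale_sqblock m n c (B : 'I_m -> 'I_m -> 'M[int]_n) :
  c *: sqblock_mx B = sqblock_mx (fun i j => c *: B i j).
Proof. by apply/matrixP=> x y; rewrite !mxE. Qed.

Lemma mul_tens_sqblock m n (P : 'M[int]_m) (Q : 'M[int]_n) B :
  (P *t Q) *m sqblock_mx B
  = sqblock_mx (fun i j => \sum_k P i k *: (Q *m B k j)).
Proof.
rewrite -sqblock_mx_tens mulmx_sqblock; apply: eq_sqblock => i j.
by apply: eq_bigr => k _; rewrite -scalemxAl.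
Qed.

Lemma mul_tens1_sqblock m n (Q : 'M[int]_n) (B : 'I_m -> 'I_m -> 'M[int]_n) :
  (1%:M *t Q) *m sqblock_mx B = sqblock_mx (fun i j => Q *m B i j).
Proof.
rewrite mul_tens_sqblock; apply: eq_sqblock => i j.
rewrite (bigD1 i) //= big1 => [|k ki]; last first.
  by rewrite mxE eq_sym (negbTE ki) scale0r.
by rewrite mxE eqxx scale1r addr0.
Qed.

Lemma tensmx11 m n : (1%:M : 'M[int]_m) *t (1%:M : 'M[int]_n) = 1%:M.
Proof.
apply/matrixP=> x y; case: (mxtens_indexP x) => i p.
case: (mxtens_indexP y) => j q; rewrite tensmxE !mxE.
by rewrite (can_eq (@mxtens_indexK m n)) xpair_eqE -natrM mulnb.
Qed.

Lemma tens1mx_eq0 m n (Q : 'M[int]_n) : (1%:M : 'M[int]_m.+1) *t Q = 0 -> Q = 0.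
Proof.
move=> Q0; apply/matrixP=> p q.
have /matrixP/(_ (mxtens_index (ord0, p)) (mxtens_index (ord0, q))) := Q0.
by rewrite tensmxE !mxE eqxx mul1r.
Qed.

Lemma tensmx_scaler m n (P : 'M[int]_m) c (Q : 'M[int]_n) :
  P *t (c *: Q) = c *: (P *t Q).
Proof. by apply/matrixP=> x y; rewrite !mxE mulrCA. Qed.

Lemma mul_Jmx n : Jmx n *m Jmx n = n%:R *: Jmx n.
Proof.
apply/matrixP=> x y; rewrite !mxE (eq_bigr (fun _ => 1)) => [|z _].
  by rewrite sumr_const card_ord mulr1.
by rewrite !mxE mulr1.
Qed.

Lemma tr_Jmx n : (Jmx n)^T = Jmx n.
Proof. exact: trmx_const. Qed.

Lemma tens_Jmx m n : Jmx m *t Jmx n = Jmx (m * n).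
Proof. by apply/matrixP=> x y; rewrite !mxE mulr1. Qed.

(** * The rank-one matrices of a Hadamard matrix *)

Section HadamardAux.

Variables (n : nat) (H : 'M[int]_n).
Hypothesis hH : hadamard H.

Lemma tr_hadamard_aux k : (hadamard_aux H k)^T = hadamard_aux H k.
Proof.
case: k => [|k] /=; first exact: trmx0.
by case: insubP => [i _ _|_]; rewrite ?trmx0 // trmx_mul trmxK.
Qed.

(** The inner factor [r_i r_j^T] is an entry of [H H^T]. The bounds exclude junk indices, and for
    index 0 both sides vanish. *)
Lemma mul_hadamard_aux k k' : (k <= n)%N -> (k' <= n)%N ->
  hadamard_aux H k *m hadamard_aux H k'
  = (if k == k' then n%:R else 0) *: hadamard_aux H k.
Proof.
case: k => [|k] lekn; first by rewrite !hadamard_aux0 mul0mx scaler0.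
case: k' => [|k'] lek'n; first by rewrite hadamard_aux0 mulmx0 scale0r.
rewrite (hadamard_auxS H (Ordinal lekn)) (hadamard_auxS H (Ordinal lek'n)).
set i := Ordinal lekn; set j := Ordinal lek'n.
rewrite mulmxA -[_ *m row i H *m _]mulmxA.
have -> : row i H *m (row j H)^T = ((n%:R : int) *+ (i == j))%:M.
  rewrite [LHS]mx11_scalar; congr _%:M.
  have := congr1 (fun M : 'M_n => M i j) hH.2; rewrite !mxE => <-.
  by apply: eq_bigr => z _; rewrite !mxE.
rewrite mul_mx_scalar -scalemxAl eqSS -val_eqE /=.
by case: eqP => [kk'|_]; rewrite ?scale0r //= mulr1n; have -> : j = i by apply: val_inj.
Qed.

Lemma hadamard_aux_entry k x y : (0 < k <= n)%N ->
  hadamard_aux H k x y = 1 \/ hadamard_aux H k x y = -1.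
Proof.
case: k => [|k] // /andP[_ lekn]; rewrite (hadamard_auxS H (Ordinal lekn)) mxE big_ord1.
rewrite !mxE; case: (hH.1 (Ordinal lekn) x) => ->; case: (hH.1 (Ordinal lekn) y) => ->.
all: by [left|right].
Qed.

Lemma hadamard_aux_diag k x : (0 < k <= n)%N -> hadamard_aux H k x x = 1.
Proof.
case: k => [|k] // /andP[_ lekn]; rewrite (hadamard_auxS H (Ordinal lekn)) mxE big_ord1.
by rewrite !mxE; case: (hH.1 (Ordinal lekn) x) => ->.
Qed.

End HadamardAux.

(** * The block matrix of a symmetric Latin square *)

Section LatinBlocks.

Variables (n : nat) (H : 'M[int]_n) (l : nat) (L : 'M['I_l.+1]_l.+1).
Hypothesis hH : hadamard H.
Hypothesis hln : (l <= n)%N.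
Hypothesis hCJ : forall i : nat, (1 <= i <= l)%N -> hadamard_aux H i *m Jmx n = 0.
Hypothesis hL : latin_square L.
Hypothesis hLsym : L^T = L.
Hypothesis hLdiag : forall i, L i i = ord0.

Local Notation C := (hadamard_aux H).
Local Notation S := (\sum_(1 <= i < l.+1) C i).
Local Notation W := (sqblock_mx (fun i j => C (L i j))).

Lemma latin_symC i j : L i j = L j i.
Proof. by have /matrixP/(_ i j) := hLsym; rewrite mxE. Qed.

Lemma latin_row_inj i : injective (L i).
Proof.
by move=> j k e; have [z [_ u]] := hL.1 i (L i j); rewrite -(u j erefl); apply: u.
Qed.

(** Row [i] already uses the symbol 0 on the diagonal, so off-diagonal blocks are never [C_0]. *)
Lemma latin_offdiag i j : i != j -> (0 < L i j <= n)%N.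
Proof.
move=> ij; rewrite (leq_trans _ hln) ?andbT; last by rewrite -ltnS.
rewrite lt0n; apply: contra ij => /eqP e; apply/eqP/(@latin_row_inj i).
by rewrite hLdiag; apply: val_inj.
Qed.

(** Each row of [L] permutes the symbols, and the symbol 0 contributes [C_0 = 0]. *)
Lemma sum_hadamard_aux_latin i : \sum_k C (L i k) = S.
Proof.
transitivity (\sum_(s < l.+1) C s).
  by rewrite [RHS](reindex_inj (@latin_row_inj i)).
by rewrite -(big_mkord xpredT C) big_ltn // add0r.
Qed.

Lemma hadamard_aux_mulJ k : (k <= l)%N -> C k *m Jmx n = 0.
Proof.
by case: k => [|k] kl; [rewrite hadamard_aux0 mul0mx|apply: hCJ].
Qed.

Lemma Jmul_hadamard_aux k : (k <= l)%N -> Jmx n *m C k = 0.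
Proof.
move=> kl; rewrite -[LHS]trmxK trmx_mul tr_hadamard_aux tr_Jmx.
by rewrite hadamard_aux_mulJ // trmx0.
Qed.

(** Orthogonality of the [C_i] leaves only the term of index [k]. *)
Lemma sum_hadamard_aux_mul k : (k <= l)%N -> S *m C k = n%:R *: C k.
Proof.
move=> kl; have [->|k0] := eqVneq k 0%N.
  by rewrite hadamard_aux0 mulmx0 scaler0.
rewrite mulmx_suml (bigD1_seq k) ?iota_uniq ?mem_index_iota ?lt0n ?k0 //=.
rewrite mul_hadamard_aux ?(leq_trans kl) // eqxx big_nat_cond big1 ?addr0 //.
move=> i /andP[/andP[_ il] ik]; rewrite mul_hadamard_aux ?(leq_trans kl) //.
  by rewrite (negbTE ik) scale0r.
exact: leq_trans hln.
Qed.

Lemma tr_sum_hadamard_aux : S^T = S.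
Proof. by rewrite linear_sum; apply: eq_bigr => k _; apply: tr_hadamard_aux. Qed.

Lemma sum_hadamard_aux_sqr : S *m S = n%:R *: S.
Proof.
rewrite {2}big_nat mulmx_sumr [in RHS]big_nat scaler_sumr.
by apply: eq_bigr => k /andP[_ kl]; apply: sum_hadamard_aux_mul.
Qed.

Lemma sum_hadamard_aux_mulJ : S *m Jmx n = 0.
Proof.
by rewrite mulmx_suml big_nat big1.
Qed.

Lemma Jmul_sum_hadamard_aux : Jmx n *m S = 0.
Proof.
by rewrite -[LHS]trmxK trmx_mul tr_sum_hadamard_aux tr_Jmx sum_hadamard_aux_mulJ trmx0.
Qed.

Lemma tr_latin_block : W^T = W.
Proof.
by rewrite tr_sqblock; apply: eq_sqblock => i j; rewrite tr_hadamard_aux latin_symC.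
Qed.

Lemma tensS_mul_latin_block : (1%:M *t S) *m W = n%:R *: W.
Proof.
rewrite mul_tens1_sqblock scale_sqblock; apply: eq_sqblock => i j.
by rewrite sum_hadamard_aux_mul // -ltnS.
Qed.

(** [J_n] kills every block of [W]; an arbitrary [P] covers both [I (x) J] and [J (x) J]. *)
Lemma tensJ_mul_latin_block (P : 'M[int]_l.+1) : (P *t Jmx n) *m W = 0.
Proof.
rewrite mul_tens_sqblock; apply/matrixP=> x y; rewrite !mxE big1 ?mxE // => k _.
by rewrite Jmul_hadamard_aux ?scaler0 // -ltnS.
Qed.

(* By symmetry of [L], equal symbols in row [i] and column [j] at the same
   position force [i = j]. *)
Lemma latin_block_sqr : W *m W = n%:R *: (1%:M *t S).
Proof.
rewrite mulmx_sqblock -sqblock_mx_tens scale_sqblock; apply: eq_sqblock => i j.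
have CC k : C (L i k) *m C (L k j) = (if i == j then n%:R else 0) *: C (L i k).
  rewrite mul_hadamard_aux ?(leq_trans _ hln) -1?ltnS //.
  rewrite val_eqE latin_symC (inj_eq (@latin_row_inj k)).
  by rewrite latin_symC.
under eq_bigr do rewrite CC.
rewrite -scaler_sumr sum_hadamard_aux_latin mxE.
by case: eqP => _; rewrite ?scale1r // !scale0r scaler0.
Qed.

End LatinBlocks.

(* Comparing row sums, [S J = 0] would force [n - 1] to divide [l]. *)
Lemma scalar_plus_complete_mulJ n l (c : int) : (0 < l)%N -> (l < n - 1)%N ->
  (l%:R%:M + c *: (Jmx n - 1%:M)) *m Jmx n <> 0.
Proof.
move=> l0 ln; have n0 : (0 < n)%N by lia.
rewrite mulmxDl -scalemxAl mulmxBl mul_Jmx mul1mx mul_scalar_mx.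
move=> /matrixP/(_ (Ordinal n0) (Ordinal n0)); rewrite !mxE !natz !mulr1 => e.
have {}e : l%:Z = - c * (n%:Z - 1) by lia.
(* With [l = -c (n - 1)], a multiplier [-c <= 0] gives [l <= 0], and [-c >= 1] gives
   [l >= n - 1]. *)
have [c0|c0] : (- c <= 0) \/ (1 <= - c) by lia.
all: by nia.
Qed.

(** * Assembling the four-class scheme *)

Lemma tnth_tuple5 T (P : T -> Prop) x0 x1 x2 x3 x4 :
  P x0 -> P x1 -> P x2 -> P x3 -> P x4 ->
  forall i, P (tnth [tuple x0; x1; x2; x3; x4] i).
Proof.
by move=> P0 P1 P2 P3 P4 [[|[|[|[|[|//]]]]] hi]; rewrite (tnth_nth x0).
Qed.

Theorem theorem5p6 (n : nat) (H : 'M[int]_n) (l : nat) (a b : int)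
    (A : 'M[int]_n) (L : 'M['I_l.+1]_l.+1) (A3 A4 : 'M[int]_(l.+1 * n))
    (hH : hadamard H)
    (hl_odd : odd l) (hl_gt1 : (1 < l)%N) (hl_lt : (l < n - 1)%N)
    (hab : a <> b)
    (hA01 : zero_one_mx A) (hAsym : A^T = A) (hAdiag : forall i, A i i = 0)
    (hsum : \sum_(1 <= i < l.+1) hadamard_aux H i
            = l%:R%:M + a *: A + b *: (Jmx n - A - 1%:M))
    (hCJ : forall i : nat, (1 <= i <= l)%N -> hadamard_aux H i *m Jmx n = 0)
    (hL : latin_square L) (hLsym : L^T = L) (hLdiag : forall i, L i i = ord0)
    (hA3 : zero_one_mx A3) (hA4 : zero_one_mx A4)
    (hA34 : disjoint_supports A3 A4)
    (hLt : sqblock_mx (fun i j => hadamard_aux H (L i j)) = A3 - A4) :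
  symmetric_assoc_scheme (d := 4)
    [tuple 1%:M; (1%:M : 'M[int]_l.+1) *t A;
           (1%:M : 'M[int]_l.+1) *t (Jmx n - A - 1%:M); A3; A4].
Proof.
have hln : (l <= n)%N by lia.
have n0 : (0 < n)%N by lia.
have l0 : (0 < l)%N by lia.
pose p0 := Ordinal n0.
set T := [tuple _; _; _; _; _].
set S := \sum_(1 <= i < l.+1) _ in hsum.
pose W := sqblock_mx (fun i j => hadamard_aux H (L i j)).
pose A1 := (1%:M : 'M[int]_l.+1) *t A.
pose A2 := (1%:M : 'M[int]_l.+1) *t (Jmx n - A - 1%:M).
pose E1 := (1%:M : 'M[int]_l.+1) *t Jmx n.
pose E2 := (1%:M : 'M[int]_l.+1) *t S.
pose E3 := Jmx l.+1 *t Jmx n.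
have SJ0 : S *m Jmx n = 0 by apply: sum_hadamard_aux_mulJ.
have JS0 : Jmx n *m S = 0 by apply: Jmul_sum_hadamard_aux.
have A12E : A2 = E1 - A1 - 1%:M.
  rewrite -tensmx11; apply/matrixP=> x y; rewrite !mxE; ring.
have E2E : E2 = l%:R *: 1%:M + a *: A1 + b *: A2.
  rewrite /E2 hsum -tensmx11; apply/matrixP=> x y; rewrite !mxE; ring.
have WE i j p q : A3 (mxtens_index (i, p)) (mxtens_index (j, q))
    - A4 (mxtens_index (i, p)) (mxtens_index (j, q)) = hadamard_aux H (L i j) p q.
  have /matrixP/(_ (mxtens_index (i, p)) (mxtens_index (j, q))) := hLt.
  by rewrite sqblock_mxE !mxE => ->.
(* On diagonal blocks [A3 - A4 = 0] and disjoint supports force both to vanish; elsewhere the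
   difference is 1 or -1, so exactly one of them is 1. *)
have A34E : A3 + A4 = E3 - E1.
  apply/matrixP=> x y; case: (mxtens_indexP x) => i p.
  case: (mxtens_indexP y) => j q; rewrite !mxE !mxtens_indexK /= !mulr1.
  have := WE i j p q; have := hA34 (mxtens_index (i, p)) (mxtens_index (j, q)).
  have := hA3 (mxtens_index (i, p)) (mxtens_index (j, q)).
  have := hA4 (mxtens_index (i, p)) (mxtens_index (j, q)).
  have [<-|ij] := eqVneq i j.
    by rewrite hLdiag hadamard_aux0 mxE; lia.
  by have [] := hadamard_aux_entry hH p q (latin_offdiag hln hL hLdiag ij); lia.
(* Transfer principle: a saturated property of the five spanning matrices holds for every class. *)
have TP P : saturated P -> P 1%:M -> P E1 -> P E2 -> P E3 -> P W ->
    forall i, P (tnth T i).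
  move=> satP P0 P1 P2 P3 P4.
  have PA1 : P A1.
    (* Eliminating [A2] from the expression of [E2] isolates [(a - b) A1]; here [a <> b] is what
       allows division. *)
    apply: (saturatedZ satP (c := a - b)); first lia.
    have -> : (a - b) *: A1 = (b - l%:R) *: 1%:M + (- b *: E1 + E2).
      by rewrite E2E A12E; apply/matrixP=> x y; rewrite !mxE; ring.
    by do 2!apply: saturatedP => //.
  apply: tnth_tuple5 => //.
  - rewrite -/A2 A12E.
    have -> : E1 - A1 - 1%:M = -1 *: A1 + (-1 *: 1%:M + E1).
      by apply/matrixP=> x y; rewrite !mxE; ring.
    by do 2!apply: saturatedP => //.
  - apply: (saturatedZ satP (c := 2)) => //.
    have -> : 2 *: A3 = -1 *: E1 + (1 *: E3 + W).
      rewrite /W hLt.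
      have -> : E3 = A3 + A4 + E1 by rewrite A34E subrK.
      by apply/matrixP=> x y; rewrite !mxE; ring.
    by do 2!apply: saturatedP => //.
  - apply: (saturatedZ satP (c := 2)) => //.
    have -> : 2 *: A4 = -1 *: E1 + (-1 *: W + E3).
      rewrite /W hLt.
      have -> : E3 = A3 + A4 + E1 by rewrite A34E subrK.
      by apply/matrixP=> x y; rewrite !mxE; ring.
    by do 2!apply: saturatedP => //.
have symE1 : E1^T = E1 by rewrite trmx_tens trmx1 tr_Jmx.
have symE2 : E2^T = E2 by rewrite trmx_tens trmx1 tr_sum_hadamard_aux.
have symE3 : E3^T = E3 by rewrite trmx_tens !tr_Jmx.
have symW : W^T = W by apply: tr_latin_block.
have satC := saturated_class_constant T.
have cT i : class_constant T (tnth T i) by move=> x y x' y'.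
have c0 : class_constant T 1%:M := cT (@Ordinal 5 0 isT).
have cA1 : class_constant T A1 := cT (@Ordinal 5 1 isT).
have cA2 : class_constant T A2 := cT (@Ordinal 5 2 isT).
have cA3 : class_constant T A3 := cT (@Ordinal 5 3 isT).
have cA4 : class_constant T A4 := cT (@Ordinal 5 4 isT).
have c1 : class_constant T E1.
  have -> : E1 = 1 *: 1%:M + (1 *: A1 + A2).
    by rewrite A12E; apply/matrixP=> x y; rewrite !mxE; ring.
  by do 2!apply: (saturatedP satC) => //.
have c2 : class_constant T E2.
  rewrite E2E -addrA; apply: (saturatedP satC) => //; apply: (saturatedP satC) => //.
  exact: (saturated_scale satC).
have c3 : class_constant T E3.
  have -> : E3 = 1 *: A3 + (1 *: A4 + E1) by rewrite !scale1r addrA A34E subrK.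
  by do 2!apply: (saturatedP satC) => //.
have cW : class_constant T W.
  rewrite /W hLt addrC -scaleN1r; exact: (saturatedP satC).
have E11 : E1 *m E1 = n%:R *: E1.
  by rewrite tensmx_mul mulmx1 mul_Jmx tensmx_scaler.
have E12 : E1 *m E2 = 0 by rewrite tensmx_mul JS0 tensmx0.
have E21 : E2 *m E1 = 0 by rewrite tensmx_mul SJ0 tensmx0.
have E13 : E1 *m E3 = n%:R *: E3.
  by rewrite tensmx_mul mul1mx mul_Jmx tensmx_scaler.
have E31 : E3 *m E1 = n%:R *: E3.
  by rewrite tensmx_mul mulmx1 mul_Jmx tensmx_scaler.
have E22 : E2 *m E2 = n%:R *: E2.
  by rewrite tensmx_mul mulmx1 sum_hadamard_aux_sqr // tensmx_scaler.
have E23 : E2 *m E3 = 0 by rewrite tensmx_mul SJ0 tensmx0.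
have E32 : E3 *m E2 = 0 by rewrite tensmx_mul JS0 tensmx0.
have E33 : E3 *m E3 = (l.+1 * n)%:R *: E3 by rewrite /E3 tens_Jmx mul_Jmx.
have E1W : E1 *m W = 0 by apply: tensJ_mul_latin_block.
have E3W : E3 *m W = 0 by apply: tensJ_mul_latin_block.
have E2W : E2 *m W = n%:R *: W by apply: tensS_mul_latin_block.
(* The products with [W] on the left follow by transposing those with [W] on the right. *)
have WE1 : W *m E1 = 0 by rewrite -symW -symE1 -trmx_mul E1W trmx0.
have WE3 : W *m E3 = 0 by rewrite -symW -symE3 -trmx_mul E3W trmx0.
have WE2 : W *m E2 = n%:R *: W.
  by rewrite -[LHS]trmxK trmx_mul symW symE2 E2W linearZ /= symW.
have WW : W *m W = n%:R *: E2 by apply: latin_block_sqr.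
pose mulE := (E11, E12, E13, E1W, E21, E22, E23, E2W, E31, E32, E33, E3W,
              WE1, WE2, WE3, WW).
have L01 : (ord0 : 'I_l.+1) != Ordinal (l0 : (1 < l.+1)%N) by [].
have L01n := latin_offdiag hln hL hLdiag L01.
apply: symmetric_assoc_scheme_class_constant.
- apply: (tnth_tuple5 (P := fun M => M != 0)).
  + apply/eqP=> /matrixP/(_ (mxtens_index (ord0, p0)) (mxtens_index (ord0, p0))).
    by rewrite !mxE eqxx.
  (* If [A] or its complement vanished, [S] would be [l I + c (J - I)] with [c] equal to [b] or [a],
     incompatible with [S J = 0]. *)
  + apply/eqP=> /tens1mx_eq0 A0.
    apply: (scalar_plus_complete_mulJ (c := b) l0 hl_lt).
    by rewrite -SJ0 hsum A0 scaler0 addr0 subr0.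
  + apply/eqP=> /tens1mx_eq0 B0.
    apply: (scalar_plus_complete_mulJ (c := a) l0 hl_lt).
    rewrite -SJ0 hsum B0 scaler0 addr0; congr ((_ + _ *: _) *m _).
    by apply/eqP; rewrite -subr_eq0 addrAC B0.
  (* An off-diagonal block has diagonal entry 1, but without [A3] it would be nonpositive. *)
  + apply/eqP=> A30.
    have := WE ord0 (Ordinal (l0 : (1 < l.+1)%N)) p0 p0.
    rewrite (hadamard_aux_diag hH) // A30 mxE sub0r.
    by case: (hA4 (mxtens_index (ord0, p0))
                  (mxtens_index (Ordinal (l0 : (1 < l.+1)%N), p0))) => ->.
  (* Without [A4] an off-diagonal block would be nonnegative with zero row sums, hence zero,
     although its diagonal entries are 1. *)
  + apply/eqP=> A40.
    set k := L ord0 (Ordinal (l0 : (1 < l.+1)%N)) in L01n.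
    have s0 : \sum_q hadamard_aux H k p0 q = 0.
      have /matrixP/(_ p0 p0) := hadamard_aux_mulJ hCJ (ltn_ord k : (k <= l)%N).
      by rewrite !mxE => {2}<-; apply: eq_bigr => q _; rewrite mxE mulr1.
    have : hadamard_aux H k p0 p0 = 0.
      apply: (psumr_eq0P _ s0) => // q _; rewrite -WE A40 mxE subr0.
      by case: (hA3 (mxtens_index (ord0, p0))
                    (mxtens_index (Ordinal (l0 : (1 < l.+1)%N), q))) => ->.
    by rewrite hadamard_aux_diag.
- apply: (tnth_tuple5 (P := @zero_one_mx _)) => // x y.
  + by rewrite mxE; case: eqP; [right|left].
  + case: (mxtens_indexP x) => i p; case: (mxtens_indexP y) => j q.
    rewrite tensmxE mxE; case: eqP => _; rewrite ?mul1r ?mul0r; last by left.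
    exact: hA01.
  + case: (mxtens_indexP x) => i p; case: (mxtens_indexP y) => j q.
    rewrite tensmxE mxE; case: eqP => _; rewrite ?mul1r ?mul0r; last by left.
    rewrite !mxE; case: eqP => [<-|_]; first by left; rewrite hAdiag.
    by case: (hA01 p q) => ->; [right|left].
- by [].
- rewrite !big_ord_recl big_ord0 !(tnth_nth 0) /= -/A1 -/A2 addr0 A34E A12E.
  by rewrite -tens_Jmx -/E3; apply/matrixP=> x y; rewrite !mxE; ring.
- apply: (TP _ (@saturated_sym _)) => //; exact: trmx1.
(* Class constancy of a product is saturated in each factor separately, so two transfers reduce it
   to products of spanning matrices, all listed in [mulE] up to identity factors. *)
- move=> i j; move: i; apply: (TP _ (saturated_mulr satC (tnth T j))).
  all: move: j; apply: (TP _ (saturated_mull satC _)).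
  all: rewrite ?mul1mx ?mulmx1 ?mulE //.
  all: by [apply: (saturated0 satC) | apply: (saturated_scale satC)].
Qed.
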